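(* Let $p\ge 5$ be a prime and let $b,c$ be integers. Set $d:=b^2-4c$ and suppose that $p\nmid d$. (i) If $p\mid c$, then $$\sum_{k=0}^{p-1}(2k+1)^3\frac{T_k(b,c)^4}{d^{2k}}\equiv -p^2\pmod{p^3}.$$ (ii) If $p\mid b$, then $$\sum_{k=0}^{p-1}(2k+1)^3\frac{T_k(b,c)^4}{d^{2k}}\equiv -p\pmod{p^3}.$$ (iii) If $p\nmid c$ and $p\nmid b$, then $$\sum_{k=0}^{p-1}(2k+1)^3\frac{T_k(b,c)^4}{d^{2k}}\equiv p\frac{d}{4c}-p^2\frac{d}{4c}\left(\frac{b^2}{4c}\left(q_p(d)-2q_p(b)\right)+1+\frac{12c}{2d}\right)\pmod{p^3}.$$
   Context: For integers $b,c$ and $n\ge 0$, $T_n(b,c)$ denotes the generalized central trinomial coefficient, i.e. the coefficient of $x^n$ in the expansion of $(x^2+bx+c)^n$. For an integer $a$ not divisible by $p$, $q_p(a):=(a^{p-1}-1)/p$ is the Fermat quotient. For rational numbers $u,v$, $u\equiv v\pmod{p^m}$ means that $u-v\in p^m\mathbb{Z}_{(p)}$, where $\mathbb{Z}_{(p)}$ is the ring of rationals with denominator not divisible by $p$. *)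

(* Defs.v *)
From HB Require Import structures.
From mathcomp Require Import all_boot all_order all_algebra.
Set Implicit Arguments.
Unset Strict Implicit.
Unset Printing Implicit Defensive.
Import Order.TTheory GRing.Theory Num.Theory.
Local Open Scope ring_scope.

(* Generalized central trinomial coefficient T_n(b, c). *)
Definition trinomial (n : nat) (b c : int) : int :=
  (('X^2 + b *: 'X + c%:P) ^+ n)`_n.

(* The Fermat quotient q_p(a), as a rational number; it is only meaningful
   when p is a prime not dividing a, in which case it is an integer. *)
Definition fermat_quotient (p : nat) (a : int) : rat :=
  (a ^+ p.-1 - 1)%:~R / p%:R.

(* The localization of the integers at p; [denq] is in lowest terms. *)
Definition Zloc (p : nat) : {pred rat} := [pred r | ~~ (p %| denq r)%Z].

Definition rat_congr (p m : nat) (u v : rat) : Prop :=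
  exists2 r : rat, r \in Zloc p & u - v = p%:R ^+ m * r.

(* [d] stands for the discriminant b ^+ 2 - 4 * c. *)
Definition trinomial_sum (p : nat) (b c d : int) : rat :=
  \sum_(0 <= k < p)
    (2 * k%:R + 1) ^+ 3 * ((trinomial k b c)%:~R ^+ 4 / d%:~R ^+ (2 * k)).

(* Main.v *)
Require Import Defs.
From HB Require Import structures.
From mathcomp Require Import all_boot all_order all_algebra.
From mathcomp Require Import ring zify.
Set Implicit Arguments.
Unset Strict Implicit.
Unset Printing Implicit Defensive.
Import Order.TTheory GRing.Theory Num.Theory.
Local Open Scope ring_scope.

(** The trinomial coefficient T_k(b,c) is d^(k/2) P_k(b / sqrt d), where P_k is
    the Legendre polynomial and d = b^2 - 4c.  Hence the sum is the value at
    x = b / sqrt d of S = sum_(k < p) (2k+1)^3 P_k^4, in which only even powers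
    of x occur: it is a polynomial in y = x^2 = b^2/d over Z_(p)
    ([trinomial_sumE]), and no square root is needed.  The three cases are
    specializations of one congruence between polynomials in y,

      (y-1)^2 S = - p + (p + 2p^2) y^p - (3/2) p^2 y^(p+1) - (1/2) p^2 y^(p-1)

    modulo p^3 ([square_sum_congruence]).

    The congruence is obtained by integration.  The sum S has no closed form,
    but the derivative of (x^2-1)^2 S has one: it telescopes
    ([legendre_form_step], [deriv_legendre_quartic_sum]), and x^3 times it is
    a quartic form in P_p and P_(p-1), divisible by p^2.  The two first order
    relations between consecutive Legendre polynomials give P_p = x^p and
    P_(p-1) = 1 modulo p, which determines the derivative modulo p^3 and hence
    every coefficient of (y-1)^2 S whose exponent is prime to p.  Three
    exponents remain.  For y^p, integration divides by p, so the form is needed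
    modulo p^4, that is P_p P_(p-1) modulo p^2 around x^p; this follows from
    (x^2-1) (P_p P_(p-1))' = p (P_p^2 - P_(p-1)^2) ([legendre_product]).
    For y^(2p), the form has no coefficient modulo p^4.  The constant
    coefficient is recovered from the zero of (y-1)^2 S at y = 1.

    If p divides b, then y is 0 modulo p^2 and S = - p.  If p divides neither
    b nor c, then y - 1 = 4c/d is invertible, and y^(p-1) is 1 modulo p with a
    quotient given by the Fermat quotients of b and d.  If p divides c, then
    y - 1 cannot be inverted; but modulo p^2 the right hand side is p (y-1)^p,
    so S = p (y-1)^(p-2) + p^2 E, and E at y is E at 1 modulo p, where
    S(1) = sum_(k < p) (2k+1)^3 = p^2 (2p^2 - 1). *)

(** * The ring Z_(p) and its ideals p^m *)

Lemma ndvd_lt (p n : nat) : (0 < n < p)%N -> ~~ (p %| n)%N.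
Proof. by case/andP=> n0 np; rewrite gtnNdvd. Qed.

Lemma Zloc_frac (p : nat) (n s : int) : ~~ (p %| s)%Z -> n%:~R / s%:~R \in Zloc p.
Proof.
move=> ps; rewrite inE; apply: contra ps => /dvdz_trans; apply.
have [->|s0] := eqVneq s 0; first exact: dvdz0.
set r : rat := _ / _.
have : denq r * n = numq r * s.
  apply/eqP; rewrite -(eqr_int rat) !rmorphM /= numqE mulrAC mulrC.
  by rewrite divfK ?intr_eq0.
move=> e; rewrite -(@Gauss_dvdzr _ (numq r)) -?e ?dvdz_mulr //.
by rewrite /coprimez /gcdz -?e; have := coprime_num_den r; rewrite coprime_sym => /eqP ->.
Qed.

Lemma Zloc_int (p : nat) (n : int) : prime p -> n%:~R \in Zloc p.
Proof.
move=> p_prime; rewrite -[_%:~R]divr1; apply: (Zloc_frac _ (s := 1)).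
by rewrite dvdz1; case: p p_prime => [|[|]].
Qed.

Section Localization.
Variables (p : nat) (p_prime : prime p).

(** The primality proof is an argument so that the subring structure, which
    depends on it, can be inferred. *)
Definition plocal of prime p : {pred rat} := Zloc p.
Notation Zp := (plocal p_prime).

Lemma plocal_frac r : r \in Zp ->
  exists2 s : int, ~~ (p %| s)%Z & exists n : int, r = n%:~R / s%:~R.
Proof. by move=> rp; exists (denq r) => //; exists (numq r); rewrite divq_num_den. Qed.

Lemma Euclid_dvdz (m n : int) : (p %| m * n)%Z = (p %| m)%Z || (p %| n)%Z.
Proof. by rewrite !dvdzE abszM /= Euclid_dvdM. Qed.

Lemma plocal_subring : subring_closed Zp.
Proof.
split=> [|r r'|r r'].
- exact: (@Zloc_int p 1).
- move=> /plocal_frac[s ps [n ->]] /plocal_frac[s' ps' [n' ->]].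
  have s0 (t : int) : ~~ (p %| t)%Z -> t%:~R != 0 :> rat.
    by rewrite intr_eq0; apply: contraNneq => ->; apply: dvdz0.
  rewrite -mulNr addf_div ?s0 // -rmorphN -!rmorphM -rmorphD /=.
  by apply: Zloc_frac; rewrite Euclid_dvdz negb_or ps.
- move=> /plocal_frac[s ps [n ->]] /plocal_frac[s' ps' [n' ->]].
  rewrite mulf_div -!rmorphM /=.
  by apply: Zloc_frac; rewrite Euclid_dvdz negb_or ps.
Qed.
HB.instance Definition _ := GRing.isSubringClosed.Build rat Zp plocal_subring.

Lemma plocal_inv (n : nat) : ~~ (p %| n)%N -> n%:R^-1 \in Zp.
Proof. by move=> pn; rewrite -[_^-1]mul1r; apply: (@Zloc_frac p 1 n). Qed.

Lemma plocal_invz (n : int) : ~~ (p %| n)%Z -> n%:~R^-1 \in Zp.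
Proof. by move=> pn; rewrite -[_^-1]mul1r; apply: (@Zloc_frac p 1 n). Qed.

Lemma natr_prime_neq0 : p%:R != 0 :> rat.
Proof. by rewrite pnatr_eq0 -lt0n prime_gt0. Qed.

Definition pideal (pp : prime p) m :=
  [pred r : rat | r / p%:R ^+ m \in plocal pp].
Notation Ip := (pideal p_prime).

Lemma pidealP m r : reflect (exists2 s, s \in Zp & r = p%:R ^+ m * s) (r \in Ip m).
Proof.
have pm0 : p%:R ^+ m != 0 :> rat by rewrite expf_neq0 // natr_prime_neq0.
apply: (iffP idP) => [rI|[s sZ ->]].
  by exists (r / p%:R ^+ m) => //; rewrite mulrC divfK.
by rewrite inE /= mulrAC divff ?mul1r.
Qed.

Lemma pideal_zmod m : zmod_closed (Ip m).
Proof.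
have inI r : (r \in Ip m) = (r / p%:R ^+ m \in Zp) by [].
split=> [|r r']; first by rewrite inI mul0r rpred0.
by rewrite !inI mulrBl => rI r'I; rewrite rpredB.
Qed.
HB.instance Definition _ m := GRing.isZmodClosed.Build rat (Ip m) (pideal_zmod m).

Lemma pideal_mulr m a r : a \in Zp -> r \in Ip m -> a * r \in Ip m.
Proof. by move=> aZ rI; rewrite -[_ \in _]/(_ / _ \in Zp) -mulrA rpredM. Qed.

Lemma pideal_divn m (n : nat) r : ~~ (p %| n)%N -> n%:R * r \in Ip m -> r \in Ip m.
Proof.
move=> pn /(pideal_mulr (plocal_inv pn)); rewrite mulKf // pnatr_eq0.
by apply: contraNneq pn => ->; apply: dvdn0.
Qed.

Lemma polyOver_pidealP m (f : {poly rat}) :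
  reflect (exists2 e, e \is a polyOver Zp & f = p%:R ^+ m * e)
          (f \is a polyOver (Ip m)).
Proof.
have natC : p%:R ^+ m = (p%:R ^+ m)%:P :> {poly rat}.
  by rewrite polyC_exp polyC_natr.
rewrite natC; apply: (iffP idP) => [/polyOverP fI|[e /polyOverP eZ ->]].
  exists ((p%:R ^+ m)^-1 *: f).
    by apply/polyOverP => i; rewrite coefZ mulrC; apply: fI.
  by rewrite mul_polyC scalerA divff ?scale1r // expf_neq0 // natr_prime_neq0.
by apply/polyOverP => i; rewrite coefCM; apply/pidealP; exists e`_i.
Qed.

(** The polynomial X^n - 1 has the unit constant coefficient -1, so the
    coefficients of f are recovered from those of the product by increasing
    induction on the exponent. *)
Lemma polyOver_divXn1 m n (f : {poly rat}) : (0 < n)%N ->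
  ('X^n - 1) * f \is a polyOver (Ip m) -> f \is a polyOver (Ip m).
Proof.
move=> n0 /polyOverP gI; apply/polyOverP => i.
have [k] := ubnP i; elim: k i => // k IHk i ik.
have := gI i; rewrite mulrBl mul1r coefB coefXnM.
case: ltnP => [_|ni]; first by rewrite sub0r rpredN.
move=> h; rewrite -[f`_i](subKr f`_(i - n)) rpredB //; apply: IHk; lia.
Qed.

Lemma polyOver_mulp (f : {poly rat}) m :
  f \is a polyOver Zp -> p%:R ^+ m * f \is a polyOver (Ip m).
Proof. by move=> fZ; apply/polyOver_pidealP; exists f. Qed.

(** The value at 1 is the sum of the coefficients; this recovers the one
    coefficient that integration leaves undetermined. *)
Lemma polyOver_pideal_but1 m k (f : {poly rat}) :
  (forall i, i != k -> f`_i \in Ip m) -> f.[1] \in Ip m ->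
  f \is a polyOver (Ip m).
Proof.
move=> fI f1; apply/polyOverP => i; have [->|/fI //] := eqVneq i k.
have [kf|] := ltnP k (size f); last by move=> h; rewrite nth_default ?rpred0.
move: f1; rewrite horner_coef (bigD1 (Ordinal kf)) //= expr1n mulr1.
set s := \sum_(_ | _) _; have sI : s \in Ip m.
  by apply: rpred_sum => j jk; rewrite expr1n mulr1 fI.
by move=> h; rewrite -[f`_k](addrK s) rpredB.
Qed.

(** Integration of a congruence, away from the exponents divisible by p. *)
Lemma deriv_pideal m (f : {poly rat}) i :
  f^`() \is a polyOver (Ip m) -> ~~ (p %| i)%N -> f`_i \in Ip m.
Proof.
case: i => [|i] /polyOverP fI pi; first by rewrite dvdn0 in pi.
by apply: (pideal_divn pi); rewrite mulr_natl -coef_deriv.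
Qed.

Lemma rat_congr_pideal m r s : r - s \in Ip m -> rat_congr p m r s.
Proof. by move=> /pidealP[t tZ tE]; exists t. Qed.

Lemma pideal_le m n r : (m <= n)%N -> r \in Ip n -> r \in Ip m.
Proof.
move=> mn /pidealP[s sZ ->]; apply/pidealP; exists (p%:R ^+ (n - m) * s).
  by rewrite rpredM ?rpredX ?rpred_nat.
by rewrite mulrA -exprD subnKC.
Qed.

Lemma polyOver_pideal_le m n (f : {poly rat}) : (m <= n)%N ->
  f \is a polyOver (Ip n) -> f \is a polyOver (Ip m).
Proof.
by move=> mn /polyOverP fI; apply/polyOverP => i; apply: (pideal_le mn).
Qed.

Lemma horner_pideal m (f : {poly rat}) x y :
  f \is a polyOver Zp -> x \in Zp -> y \in Zp -> x - y \in Ip m ->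
  f.[x] - f.[y] \in Ip m.
Proof.
move=> /polyOverP fZ xZ yZ xyI; rewrite !horner_coef -sumrB.
apply: rpred_sum => i _; rewrite -mulrBr subrXX.
apply: pideal_mulr => //; rewrite mulrC; apply: pideal_mulr => //.
by apply: rpred_sum => j _; rewrite rpredM ?rpredX.
Qed.

Lemma binomial_prime (a : {poly rat}) : a \is a polyOver Zp ->
  (a + 1) ^+ p - a ^+ p - 1 \is a polyOver (Ip 1).
Proof.
move=> aZ; rewrite exprDn (bigD1 ord0) //= (bigD1 ord_max) /=; last first.
  by rewrite -val_eqE /= -lt0n prime_gt0.
rewrite subn0 subnn bin0 binn !expr1n expr0 !mulr1 !mulr1n; set s := \sum_(_ | _) _.
have -> : a ^+ p + (1 + s) - a ^+ p - 1 = s by ring.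
apply: rpred_sum => i /andP[i0 ip]; rewrite expr1n mulr1 -mulr_natr mulrC.
have {ip i0} ip : (0 < i < p)%N.
  by rewrite lt0n [(_ != _)%N]i0 ltn_neqAle [(_ != _)%N]ip -ltnS ltn_ord.
have /dvdnP[t ->] : (p %| 'C(p, i))%N by exact: prime_dvd_bin.
rewrite natrM [t%:R * _]mulrC -mulrA -[p%:R]expr1; apply: polyOver_mulp.
by rewrite rpredM ?rpredX ?rpred_nat.
Qed.

End Localization.

(** * Central trinomial coefficients over a commutative ring *)

Definition central_coef (R : comNzRingType) n (b c : R) : R :=
  (('X^2 + b *: 'X + c%:P) ^+ n)`_n.

Definition central_mult n j : nat := ('C(n, j) * 'C(n - j, n - j.*2))%N.

Lemma coef_linear_exp (R : comNzRingType) (b c : R) k m : (m <= k)%N ->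
  ((b *: 'X + c%:P) ^+ k)`_m = b ^+ m * c ^+ (k - m) *+ 'C(k, m).
Proof.
move=> mk; rewrite addrC exprDn coef_sum.
rewrite (bigD1 (Ordinal (mk : (m < k.+1)%N))) //= big1 => [|i im].
  rewrite addr0 coefMn -polyC_exp coefCM exprZn coefZ coefXn eqxx mulr1.
  by rewrite mulrC.
rewrite coefMn -polyC_exp coefCM exprZn coefZ coefXn eq_sym.
by rewrite -[(_ == m)%N]/(i == Ordinal (mk : (m < k.+1)%N)) (negPf im) !mulr0 mul0rn.
Qed.

Lemma central_coefE (R : comNzRingType) n (b c : R) :
  central_coef n b c = \sum_(j < n.+1 | (j.*2 <= n)%N)
                b ^+ (n - j.*2) * c ^+ j *+ central_mult n j.
Proof.
rewrite /central_coef -addrA addrC exprDn coef_sum [RHS]big_mkcond.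
apply: eq_bigr => j _; rewrite coefMn -exprM coefMXn mul2n ltnNge.
case: leqP => //= jn; last by rewrite mul0rn.
rewrite coef_linear_exp; last by rewrite leq_sub2l // -addnn leq_addr.
by rewrite -mulrnA [in LHS]mulnC /central_mult; congr (_ * _ ^+ _ *+ _); lia.
Qed.

(** The square of the n-th central coefficient is homogeneous of degree n in
    b^2 and c; this is the form in which it is divided by d^n with
    y = b^2/d and z = c/d, whatever the parity of n. *)
Definition central_sq (R : comNzRingType) n (y z : R) : R :=
  \sum_(i < n.+1 | (i.*2 <= n)%N) \sum_(j < n.+1 | (j.*2 <= n)%N)
    y ^+ (n - i - j) * z ^+ (i + j) *+ (central_mult n i * central_mult n j).

Lemma central_coef_sqr (R : comNzRingType) n (b c e y z : R) :
  b ^+ 2 = e * y -> c = e * z -> central_coef n b c ^+ 2 = e ^+ n * central_sq n y z.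
Proof.
move=> be ce; rewrite expr2 central_coefE mulr_suml mulr_sumr.
apply: eq_bigr => i ilen; rewrite !mulr_sumr; apply: eq_bigr => j jlen.
rewrite mulrnAl mulrnAr -mulrnA mulrnAr mulnC; congr (_ *+ _).
have -> : b ^+ (n - i.*2) * c ^+ i * (b ^+ (n - j.*2) * c ^+ j)
        = (b ^+ 2) ^+ (n - i - j) * c ^+ (i + j).
  rewrite -exprM mulrACA -!exprD; congr (_ ^+ _ * _); lia.
rewrite be ce !exprMn mulrACA -exprD; congr (_ ^+ _ * _); lia.
Qed.

Lemma rmorph_central_sq (R S : comNzRingType) (f : {rmorphism R -> S}) n y z :
  f (central_sq n y z) = central_sq n (f y) (f z).
Proof.
rewrite rmorph_sum; apply: eq_bigr => i _; rewrite rmorph_sum.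
by apply: eq_bigr => j _; rewrite rmorphMn rmorphM !rmorphXn.
Qed.

Lemma rmorph_central_coef (R S : comNzRingType) (f : {rmorphism R -> S}) n b c :
  f (central_coef n b c) = central_coef n (f b) (f c).
Proof.
rewrite !central_coefE rmorph_sum; apply: eq_bigr => i _.
by rewrite rmorphMn rmorphM !rmorphXn.
Qed.

(** * Legendre polynomials *)

(** The discriminant of t^2 + x t + (x^2-1)/4 is 1, so this is the classical
    Legendre polynomial. *)
Definition legendre n : {poly rat} := central_coef n 'X (4^-1%:P * ('X^2 - 1)).

(** The square of the Legendre polynomial as a polynomial in y = x^2. *)
Definition legendre_sq n : {poly rat} := central_sq n 'X (4^-1%:P * ('X - 1)).

Lemma legendre_sqE n : legendre_sq n \Po 'X^2 = legendre n ^+ 2.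
Proof.
rewrite (@central_coef_sqr _ _ _ _ 1 'X^2 (4^-1%:P * ('X^2 - 1))) ?mul1r //.
rewrite expr1n mul1r /legendre_sq -[LHS]/(comp_poly 'X^2 _) rmorph_central_sq /=.
by rewrite comp_polyX comp_polyM comp_polyB comp_polyX !comp_polyC.
Qed.

Lemma legendre_sq_at n (b c d : rat) : d != 0 -> d = b ^+ 2 - 4 * c ->
  (legendre_sq n).[b ^+ 2 / d] = central_coef n b c ^+ 2 / d ^+ n.
Proof.
move=> d0 dE; rewrite (@central_coef_sqr _ _ _ _ d (b ^+ 2 / d) (c / d)).
- rewrite [RHS]mulrC mulKf ?expf_neq0 // -[LHS]/(horner_eval _ _) rmorph_central_sq /=.
  rewrite /horner_eval hornerX hornerM !hornerE; congr central_sq.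
  by rewrite dE; field; rewrite -dE.
- by rewrite mulrC divfK.
- by rewrite mulrC divfK.
Qed.

Lemma size_legendre n : (size (legendre n) <= n.+1)%N.
Proof.
rewrite /legendre central_coefE; apply: leq_trans (size_sum _ _ _) _.
apply/bigmax_leqP => i ile.
rewrite -scaler_nat; apply: leq_trans (size_scale_leq _ _) _.
rewrite exprMn -polyC_exp mulrCA mul_polyC; apply: leq_trans (size_scale_leq _ _) _.
rewrite mulrC; apply: leq_trans (size_polyMleq _ _) _; rewrite size_polyXn.
have : (size ((('X^2 - 1) : {poly rat}) ^+ i) <= i.*2.+1)%N.
  apply: leq_trans (size_poly_exp_leq _ _) _.
  by rewrite size_XnsubC //= mul2n.
move: (size _) => s; lia.
Qed.

(** The derivation with respect to x of polynomials in t over R[x]. *)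
Definition deriv_coefs (R : comNzRingType) (f : {poly {poly R}}) : {poly {poly R}} :=
  map_poly (@deriv R) f.

Lemma coef_deriv_coefs (R : comNzRingType) (f : {poly {poly R}}) i :
  (deriv_coefs f)`_i = (f`_i)^`().
Proof. by rewrite coef_map_id0 // deriv0. Qed.

Lemma deriv_coefsM (R : comNzRingType) (f g : {poly {poly R}}) :
  deriv_coefs (f * g) = deriv_coefs f * g + f * deriv_coefs g.
Proof.
apply/polyP => i; rewrite coefD !coef_deriv_coefs !coefM raddf_sum -big_split /=.
by apply: eq_bigr => j _; rewrite derivM !coef_deriv_coefs.
Qed.

Lemma deriv_coefsX (R : comNzRingType) (f : {poly {poly R}}) n :
  deriv_coefs (f ^+ n) = deriv_coefs f * f ^+ n.-1 *+ n.
Proof.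
case: n => [|n].
  apply/polyP => i; rewrite coef_deriv_coefs coef1 mulr0n coef0.
  by case: i => [|i]; rewrite ?derivC ?deriv0.
elim: n => [|n IHn]; first by rewrite mulr1.
by rewrite exprS deriv_coefsM IHn /= mulrnAr mulrCA -exprS -mulrS.
Qed.

Definition legendre_gen : {poly {poly rat}} := 'X^2 + 'X *: 'X + (4^-1%:P * ('X^2 - 1))%:P.

Lemma legendre_coef n : legendre n = (legendre_gen ^+ n)`_n.
Proof. by []. Qed.

Lemma deriv_coefs_legendre_gen : deriv_coefs legendre_gen = 'X + (2^-1%:P * 'X)%:P.
Proof.
apply/polyP => i; rewrite coef_deriv_coefs /legendre_gen !coefD coefZ !coefX coefXn !coefC.
case: i => [|[|[|i]]] //=; rewrite ?mulr0 ?mulr1 ?add0r ?addr0 ?derivX ?deriv0 //.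
- rewrite derivM derivB derivC mul0r add0r derivXn derivC subr0 expr1 mulr2n.
  by rewrite mulrDr -!mulrDl -polyCD.
by rewrite derivC.
Qed.

Lemma deriv_legendre_gen : legendre_gen^`() = 'X *+ 2 + 'X%:P.
Proof.
by rewrite /legendre_gen !derivD derivZ derivX derivXn derivC addr0 expr1 alg_polyC.
Qed.

(** The t-derivative of t^2 + x t + (x^2-1)/4 is twice its x-derivative.  All
    the differential relations below come from this identity. *)
Lemma legendre_gen_deriv : legendre_gen^`() = deriv_coefs legendre_gen *+ 2.
Proof.
rewrite deriv_legendre_gen deriv_coefs_legendre_gen mulrnDl -polyCMn -mulrnAl -polyCMn.
by rewrite -[2^-1 *+ 2]mulr_natr mulVf // polyC1 mul1r.
Qed.

Lemma legendre_deriv_coef n : (n.+1)%:R * (legendre_gen ^+ n)`_n.+1 = 2 * (legendre n)^`().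
Proof.
rewrite legendre_coef -coef_deriv_coefs deriv_coefsX !mulr_natl.
rewrite -coef_deriv -coefMn deriv_exp legendre_gen_deriv mulrnAl mulrnAC.
by rewrite [deriv_coefs _ * _]mulrC mulrC.
Qed.

(** With q the generating quadratic, this reads the coefficient of t^n in
    (q^(n+1))' = (n+1) q' q^n. *)
Lemma legendre_succ_deriv n : legendre n.+1 = 'X * legendre n + 2 * ('X * legendre_gen ^+ n)`_n.
Proof.
have nz : n.+1%:R != 0 :> {poly rat} by rewrite -polyC_natr polyC_eq0 pnatr_eq0.
apply: (mulfI nz); rewrite !mulr_natl legendre_coef -coef_deriv deriv_exp /=.
rewrite coefMn deriv_legendre_gen mulrDl coefD coefCM mulrnAl coefMn.
by rewrite addrC.
Qed.

(** This reads the coefficient of t^(n+1) in q * q^n. *)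
Lemma legendre_succ_mul n : legendre n.+1 =
  'X * legendre n + ('X * legendre_gen ^+ n)`_n + 4^-1%:P * ('X^2 - 1) * (legendre_gen ^+ n)`_n.+1.
Proof.
rewrite legendre_coef exprS {1}/legendre_gen !mulrDl !coefD coefCM -scalerAl coefZ.
rewrite expr2 -['X * 'X * _]mulrA [('X * ('X * _))`_ _]coefXM /= [_ + 'X * _]addrC.
by rewrite [('X * _)`_n.+1]coefXM.
Qed.

(** Comparison of the two previous expressions eliminates the coefficient of
    t^(n-1) in q^n. *)
Lemma legendre_succ n : 2 * legendre n.+1 =
  2 * ('X * legendre n) + ('X^2 - 1) * (legendre_gen ^+ n)`_n.+1.
Proof.
have e1 := legendre_succ_deriv n; have := legendre_succ_mul n.
set F := ('X * _)`_n in e1 *; set E := (legendre_gen ^+ n)`_n.+1.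
have c4 : 4^-1%:P * 4 = 1 :> {poly rat}.
  by rewrite -(polyC_natr _ 4) -polyCM mulVf.
move=> e2; have -> : ('X^2 - 1) * E = 4 * (4^-1%:P * ('X^2 - 1) * E).
  by rewrite !mulrA [4 * _]mulrC c4 mul1r.
have -> : 4^-1%:P * ('X^2 - 1) * E = F.
  move: e1; rewrite {}e2 -addrA => /addrI; rewrite mulr_natl mulr2n.
  by move/addrI.
rewrite e1; ring.
Qed.

Lemma legendre_deriv_lower n :
  ('X^2 - 1) * (legendre n)^`() = n.+1%:R * (legendre n.+1 - 'X * legendre n).
Proof.
have nz : 2%:R != 0 :> {poly rat} by rewrite -polyC_natr polyC_eq0 pnatr_eq0.
apply: (mulfI nz); have h1 := legendre_deriv_coef n; have h2 := legendre_succ n.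
rewrite mulrCA -h1 mulrCA [in RHS]mulrCA mulrBr h2; ring.
Qed.

Lemma legendre_deriv_upper n :
  ('X^2 - 1) * (legendre n.+1)^`() = n.+1%:R * ('X * legendre n.+1 - legendre n).
Proof.
have nz : 2%:R != 0 :> {poly rat} by rewrite -polyC_natr polyC_eq0 pnatr_eq0.
have h2 := legendre_succ n.
have h : 2 * (legendre n.+1)^`() = n.+1%:R * (2 * legendre n + 'X * (legendre_gen ^+ n)`_n.+1).
  rewrite [in LHS]legendre_coef -coef_deriv_coefs deriv_coefsX deriv_coefs_legendre_gen /=.
  rewrite coefMn [('X + _) * _]mulrDl coefD coefXM coefCM /= -legendre_coef !mulr_natl.
  rewrite mulrnAC; congr (_ *+ _).
  by rewrite mulrnDl -!mulrnAl -polyCMn -[2^-1 *+ 2]mulr_natr mulVf // mul1r.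
apply: (mulfI nz); rewrite mulrCA h.
set E := (legendre_gen ^+ n)`_n.+1 in h2 *; set P1 := legendre _ in h2 *; set P := legendre n in h2 *.
transitivity (n.+1%:R * (2 * ('X^2 - 1) * P + 'X * (2 * P1 - 2 * ('X * P)))).
  rewrite h2; ring.
ring.
Qed.

Lemma legendre0 : legendre 0 = 1.
Proof. by rewrite legendre_coef expr0 coef1. Qed.

Lemma natr_double1 (R : pzSemiRingType) n : n.*2.+1%:R = 2 * n%:R + 1 :> R.
Proof. by rewrite -muln2 -natr1 natrM mulr_natr mulr_natl. Qed.

(** Both first order relations express the derivative of P_(n+1). *)
Lemma legendre_three_term n :
  n.+1%:R * legendre n.+1
  = n.*2.+1%:R * 'X * legendre n - n%:R * legendre n.-1.
Proof.
case: n => [|n] /=.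
  have := legendre_deriv_lower 0; rewrite legendre0 derivC mulr0 mul0r subr0.
  by rewrite !mul1r !mulr1 => /esym/eqP; rewrite subr_eq0 => /eqP.
have := legendre_deriv_lower n.+1; rewrite legendre_deriv_upper.
rewrite !mulrBr => /eqP; rewrite eq_sym subr_eq => /eqP ->.
rewrite natr_double1 -[n.+2%:R]natr1; ring.
Qed.

Lemma legendre_at1 n : (legendre n).[1] = 1.
Proof.
elim: n => [|n IHn]; first by rewrite legendre0 hornerC.
have /(congr1 (horner^~ 1)) := legendre_deriv_lower n.
rewrite hornerM hornerD hornerXn hornerN hornerC expr1n subrr mul0r.
rewrite hornerM hornerD hornerN hornerM hornerX IHn mul1r => /esym/eqP.
rewrite -polyC_natr hornerC mulf_eq0 pnatr_eq0 /= subr_eq0.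
by move/eqP.
Qed.

Lemma legendre_odd_at0 n : odd n -> (legendre n).[0] = 0.
Proof.
move=> n_odd; rewrite -(odd_double_half n) n_odd add1n.
have step m : (legendre m.-1).[0] = 0 \/ m = 0%N -> (legendre m.+1).[0] = 0.
  have /(congr1 (horner^~ 0)) := legendre_three_term m.
  rewrite hornerM hornerD hornerN !hornerM hornerX mulr0 mul0r sub0r.
  rewrite -!polyC_natr !hornerC => e h.
  apply/eqP; move/eqP: e; case: h => ->; rewrite ?mulr0 ?mul0r oppr0.
    by rewrite mulf_eq0 pnatr_eq0.
  by rewrite mul1r.
elim: n./2 => [|k IHk]; apply: step; [by right | by left].
Qed.

(** * Telescoping of the quartic sum *)

(** The form of degree 4 in P_n and P_(n-1) whose increment in n is x^3 times the
    derivative of (x^2-1)^2 (2n+1)^3 P_n^4.  Its argument U stands for n P_n, as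
    the recurrence gives (n+1) P_(n+1) without denominator. *)
Definition legendre_form (R : comNzRingType) (n x U v : R) : R :=
  x ^+ 2 * U ^+ 4 + (2 * (x - x ^+ 3) - 4 * n * x ^+ 3) * U ^+ 3 * v
  + ((1 + 2 * x ^+ 2 - 3 * x ^+ 4) + n ^+ 2 * (12 * x ^+ 4 - 6 * x ^+ 2))
     * U ^+ 2 * v ^+ 2
  - n ^+ 2 * (2 * (x - x ^+ 3) + 4 * n * x ^+ 3) * U * v ^+ 3
  + n ^+ 4 * x ^+ 2 * v ^+ 4.

Lemma legendre_form_step (R : comNzRingType) (n x u v U : R) :
  U = (2 * n + 1) * x * u - n * v ->
  legendre_form (n + 1) x U u - legendre_form n x (n * u) v
  = 4 * x ^+ 3 * (x ^+ 2 - 1) * (2 * n + 1) ^+ 3 * u ^+ 3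
      * ((n + 1) * x * u - n * v).
Proof. by move=> ->; rewrite /legendre_form; ring. Qed.

Definition legendre_quartic_sum n : {poly rat} :=
  \sum_(k < n) k.*2.+1%:R ^+ 3 * legendre k ^+ 4.

Lemma deriv_legendre_quartic_sum n :
  'X^3 * (('X^2 - 1) ^+ 2 * legendre_quartic_sum n)^`()
  = legendre_form n%:R 'X (n%:R * legendre n) (legendre n.-1).
Proof.
elim: n => [|n IHn].
  rewrite /legendre_quartic_sum big_ord0 mulr0 deriv0 mulr0 mul0r.
  by rewrite /legendre_form; ring.
rewrite /legendre_quartic_sum big_ord_recr /= -/(legendre_quartic_sum n).
rewrite mulrDr derivD mulrDr {}IHn addrC; apply/eqP; rewrite eq_sym -subr_eq; apply/eqP.
have := legendre_three_term n; rewrite natr_double1 => /legendre_form_step.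
rewrite natr1 => ->.
have upper : ('X^2 - 1) * (legendre n)^`() = n%:R * ('X * legendre n - legendre n.-1).
  case: n => [|n]; last exact: legendre_deriv_upper.
  by rewrite legendre0 derivC mulr0 mul0r.
set P := legendre n in upper *; set Q := legendre n.-1 in upper *.
have -> : (('X^2 - 1) ^+ 2 * ((2 * n%:R + 1) ^+ 3 * P ^+ 4))^`()
   = 4 * ('X^2 - 1) * (2 * n%:R + 1) ^+ 3 * P ^+ 3 * ('X * P + ('X^2 - 1) * P^`()).
  have -> : (2 * n%:R + 1) ^+ 3 = ((2 * n%:R + 1) ^+ 3)%:P :> {poly rat}.
    by rewrite !(polyC_exp, polyCD, polyCM, polyC_natr).
  rewrite mulrCA derivM derivC mul0r add0r derivM !deriv_exp derivB derivXn derivC subr0 /=.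
  ring.
rewrite upper -natr1; ring.
Qed.

(** The sum as a polynomial in y = x^2. *)
Definition square_sum n : {poly rat} :=
  \sum_(k < n) k.*2.+1%:R ^+ 3 * legendre_sq k ^+ 2.

Lemma square_sumE n : square_sum n \Po 'X^2 = legendre_quartic_sum n.
Proof.
rewrite -[LHS]/(comp_poly 'X^2 _) rmorph_sum; apply: eq_bigr => k _.
by rewrite rmorphM !rmorphXn rmorph_nat /= legendre_sqE -exprM.
Qed.

Lemma trinomial_sumE p (b c d : int) : d != 0 -> d = b ^+ 2 - 4 * c ->
  trinomial_sum p b c d = (square_sum p).[b%:~R ^+ 2 / d%:~R].
Proof.
move=> d0 dE; rewrite /trinomial_sum big_mkord horner_sum; apply: eq_bigr => k _.
have -> : (trinomial k b c)%:~R = central_coef k b%:~R c%:~R :> rat.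
  exact: (rmorph_central_coef intr k b c).
rewrite hornerM !horner_exp (@legendre_sq_at _ _ c%:~R) ?intr_eq0 //; last first.
  by rewrite dE rmorphB rmorphXn rmorphM.
rewrite -polyC_natr hornerC natr_double1 exprMn exprVn -!exprM.
by rewrite mulnC.
Qed.

Lemma square_sum_at1 n : (square_sum n).[1] = n%:R ^+ 2 * (2 * n%:R ^+ 2 - 1).
Proof.
have sq1 k : (legendre_sq k).[1] = 1.
  have /(congr1 (horner^~ 1)) := legendre_sqE k.
  by rewrite horner_comp hornerXn expr1n horner_exp legendre_at1 expr1n.
elim: n => [|n IHn]; first by rewrite /square_sum big_ord0 horner0 mul0r.
rewrite /square_sum big_ord_recr hornerD -/(square_sum n) IHn /=.
rewrite hornerM !horner_exp sq1 -polyC_natr hornerC natr_double1 -natr1; ring.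
Qed.

Lemma size_legendre_quartic_sum n : (size (legendre_quartic_sum n) <= n * 4 - 3)%N.
Proof.
apply: leq_trans (size_sum _ _ _) _; apply/bigmax_leqP => k _.
rewrite -polyC_natr -polyC_exp mul_polyC; apply: leq_trans (size_scale_leq _ _) _.
apply: leq_trans (size_poly_exp_leq _ _) _.
have := size_legendre k; have := ltn_ord k; move: (size _) => s; lia.
Qed.

Lemma square_sum_comp n : (('X - 1) ^+ 2 * square_sum n) \Po 'X^2
  = ('X^2 - 1) ^+ 2 * legendre_quartic_sum n.
Proof. by rewrite comp_polyM rmorphXn /= comp_polyB comp_polyX comp_polyC square_sumE. Qed.

(** The substitution y = x^2 turns y^m into x^(2m); differentiation and
    multiplication by x^3 move it to the exponent 2m+2. *)
Lemma coef_square_sum_deriv n m :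
  ('X^3 * (('X^2 - 1) ^+ 2 * legendre_quartic_sum n)^`())`_(m.*2.+2)
  = m.*2%:R * (('X - 1) ^+ 2 * square_sum n)`_m.
Proof.
rewrite -square_sum_comp coefXnM; case: m => [|m]; first by rewrite mul0r.
rewrite (_ : (m.+1.*2.+2 < 3)%N = false); last by lia.
rewrite (_ : m.+1.*2.+2 - 3 = m.*2.+1)%N; last by lia.
rewrite coef_deriv coef_comp_poly_Xn // (_ : m.*2.+2 = m.+1 * 2)%N; last by lia.
by rewrite dvdn_mull // mulnK // mulr_natl -muln2.
Qed.

(** * Legendre polynomials of index p and p-1 *)

Section AtPrime.
Variables (p : nat) (p_prime : prime p) (p_ge5 : (5 <= p)%N).
Notation Zp := (plocal p_prime).
Notation Ip := (pideal p_prime).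

Lemma small_ndvd n : (0 < n < 5)%N -> ~~ (p %| n)%N.
Proof. by case/andP=> n0 n5; rewrite ndvd_lt // n0 (leq_trans n5). Qed.

Lemma prime_odd5 : odd p.
Proof. by case: (even_prime p_prime) p_ge5 => // ->. Qed.

Lemma legendre_Zp n : legendre n \is a polyOver Zp.
Proof.
rewrite /legendre central_coefE; apply: rpred_sum => i _; apply/rpredMn/rpredM/rpredX.
  exact/rpredX/polyOverX.
rewrite rpredM ?rpredB ?rpred1 ?rpredX ?polyOverX // polyOverC.
by apply: (plocal_inv _ (n := 4)); apply: small_ndvd.
Qed.

Lemma legendre_sq_Zp n : legendre_sq n \is a polyOver Zp.
Proof.
apply: rpred_sum => i _; apply: rpred_sum => j _; apply/rpredMn/rpredM/rpredX.
  exact/rpredX/polyOverX.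
rewrite rpredM ?rpredB ?rpred1 ?polyOverX // polyOverC.
by apply: (plocal_inv _ (n := 4)); apply: small_ndvd.
Qed.

Local Notation u := (legendre p).
Local Notation v := (legendre p.-1).

Lemma legendre_prime_deriv : ('X^2 - 1) * u^`() = p%:R * ('X * u - v).
Proof. by have := legendre_deriv_upper p.-1; rewrite prednK // prime_gt0. Qed.

Lemma legendre_pred_prime_deriv : ('X^2 - 1) * v^`() = p%:R * (u - 'X * v).
Proof. by have := legendre_deriv_lower p.-1; rewrite prednK // prime_gt0. Qed.

(** The derivative vanishes modulo p and the degree is less than p, so only
    the constant coefficient survives; the value at 1 determines it. *)
Lemma legendre_pred_prime_mod : exists2 e, e \is a polyOver Zp & v = 1 + p%:R * e.
Proof.
suff /polyOver_pidealP[e eZ eE] : v - 1 \is a polyOver (Ip 1).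
  by exists e => //; rewrite expr1 in eE; rewrite -eE addrC subrK.
apply: (@polyOver_pideal_but1 _ p_prime _ 0) => [i i0|]; last first.
  by rewrite hornerD hornerN hornerC legendre_at1 subrr rpred0.
rewrite coefB coef1 (negPf i0) subr0; have [pi|ip] := leqP p i.
  by rewrite nth_default ?rpred0 // (leq_trans (size_legendre _)) // prednK ?prime_gt0.
apply: deriv_pideal; last by rewrite ndvd_lt // ip lt0n i0.
apply: (@polyOver_divXn1 _ _ _ 2) => //; rewrite legendre_pred_prime_deriv -[p%:R]expr1.
by rewrite polyOver_mulp // rpredB ?rpredM ?polyOverX ?legendre_Zp.
Qed.

(** As above, but the degree p leaves the coefficients at 0 and p; the first
    one vanishes because p is odd. *)
Lemma legendre_prime_mod : exists2 e, e \is a polyOver Zp & u = 'X^p + p%:R * e.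
Proof.
suff /polyOver_pidealP[e eZ eE] : u - 'X^p \is a polyOver (Ip 1).
  by exists e => //; rewrite expr1 in eE; rewrite -eE addrC subrK.
apply: (@polyOver_pideal_but1 _ p_prime _ p) => [i i0|]; last first.
  by rewrite hornerD hornerN hornerXn legendre_at1 expr1n subrr rpred0.
rewrite coefB coefXn (negPf i0) subr0; have [pi|ip] := leqP p.+1 i.
  by rewrite nth_default ?rpred0 // (leq_trans (size_legendre _)).
have [->|i1] := eqVneq i 0%N.
  by rewrite -horner_coef0 legendre_odd_at0 ?rpred0 ?prime_odd5.
apply: deriv_pideal; last by apply: ndvd_lt; lia.
apply: (@polyOver_divXn1 _ _ _ 2) => //; rewrite legendre_prime_deriv -[p%:R]expr1.
by rewrite polyOver_mulp // rpredB ?rpredM ?polyOverX ?legendre_Zp.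
Qed.

Lemma coef_geom_even n m :
  (\sum_(i < n) 'X^2 ^+ i : {poly rat})`_m = (~~ odd m && (m < n.*2)%N)%:R.
Proof.
elim: n => [|n IHn]; first by rewrite big_ord0 coef0 ltn0 andbF.
rewrite big_ord_recr /= coefD IHn -exprM coefXn -natrD mul2n; congr (_%:R).
case: (eqVneq m n.*2) => [->|]; first by rewrite odd_double doubleS; lia.
by move=> mn /=; rewrite addn0; congr (nat_of_bool _); apply/idP/idP; lia.
Qed.

(** The polynomial g is the deviation of P_p P_(p-1) from x^p.  Dividing
    (x^2-1) (P_p P_(p-1))' = p (P_p^2 - P_(p-1)^2) by p gives, modulo p,
    (x^2-1) (x^(p-1) + g') = x^(2p) - 1, that is
    g' = sum_(i < p) x^(2i) - x^(p-1). *)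
Lemma legendre_product : exists g : {poly rat},
  [/\ g \is a polyOver Zp, u * v = 'X^p + p%:R * g, (size g <= p.*2)%N,
      g.[1] = 0 /\ g`_0 = 0
    & forall i, i.+1%:R * g`_i.+1 + (i == p.-1)%:R
                 - (~~ odd i && (i < p.*2)%N)%:R \in Ip 1].
Proof.
have [e1 e1Z uE] := legendre_prime_mod; have [e2 e2Z vE] := legendre_pred_prime_mod.
have p_odd := prime_odd5.
have pnz : p%:R != 0 :> {poly rat}.
  by rewrite -polyC_natr polyC_eq0 natr_prime_neq0.
pose g := e1 + 'X^p * e2 + p%:R * e1 * e2; exists g.
have gZ : g \is a polyOver Zp.
  by rewrite !rpredD ?rpredM ?rpredX ?polyOverX ?rpred_nat.
have gE : u * v = 'X^p + p%:R * g by rewrite uE vE /g; ring.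
have sg : (size g <= p.*2)%N.
  have -> : g = p%:R^-1 *: (u * v - 'X^p).
    rewrite gE ['X^p + _]addrC addrK -polyC_natr mul_polyC scalerA mulVf ?scale1r //.
    exact: natr_prime_neq0.
  apply: leq_trans (size_scale_leq _ _) _; apply: leq_trans (size_polyD _ _) _.
  rewrite geq_max size_polyN size_polyXn; apply/andP; split; last by lia.
  apply: leq_trans (size_polyMleq _ _) _.
  have := size_legendre p; have := size_legendre p.-1.
  by move: (size _) (size _) => s1 s2; lia.
have g1 : g.[1] = 0.
  have /(congr1 (horner^~ 1)) := gE.
  rewrite hornerD !hornerM !legendre_at1 hornerXn expr1n mulr1.
  rewrite -{1}[1]addr0 => /addrI/esym/eqP; rewrite mulf_eq0 -polyC_natr hornerC.
  by rewrite (negPf (natr_prime_neq0 p_prime)) => /eqP.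
have g0 : g`_0 = 0.
  have /(congr1 (horner^~ 0)) := gE.
  rewrite hornerD !hornerM legendre_odd_at0 // hornerXn -polyC_natr hornerC.
  rewrite mul0r expr0n eqn0Ngt prime_gt0 //= add0r => /esym/eqP.
  by rewrite mulf_eq0 (negPf (natr_prime_neq0 p_prime)) horner_coef0 => /eqP.
have dgI : g^`() + 'X^(p.-1) - \sum_(i < p) 'X^2 ^+ i \is a polyOver (Ip 1).
  apply: (@polyOver_divXn1 _ _ _ 2) => //.
  rewrite mulrBr mulrDr -subrX1.
  have : ('X^2 - 1) * (u * v)^`() = p%:R * (u ^+ 2 - v ^+ 2).
    rewrite derivM mulrDr mulrA legendre_prime_deriv mulrCA legendre_pred_prime_deriv; ring.
  have -> : (u * v)^`() = p%:R * ('X^(p.-1) + g^`()).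
    by rewrite gE derivD derivXn mulr_natl derivMn mulrDr !mulr_natl.
  rewrite mulrCA => /(mulfI pnz) dE.
  set f := (f in f \is a _).
  have -> : f = p%:R ^+ 1 * (2 * 'X^p * e1 + p%:R * e1 ^+ 2 - 2 * e2 - p%:R * e2 ^+ 2).
    have -> : f = (('X^2 - 1) * ('X^(p.-1) + g^`())) - ('X^p ^+ 2 - 1).
      by rewrite /f -!exprM mulnC; ring.
    rewrite dE uE vE; ring.
  by rewrite polyOver_mulp // !(rpred_nat, rpredB, rpredD, rpredM, rpredX, polyOverX).
split=> // i; have /polyOverP/(_ i) := dgI.
by rewrite coefB coefD coef_deriv coefXn coef_geom_even -[g`_i.+1 *+ _]mulr_natl.
Qed.

(** The derivative of g gives (p+2) g_(p+2) = (p-2) g_(p-2) = 1 modulo p.  It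
    says nothing about g_p; but it gives i g_i = j g_j for i + j = 2p, hence
    g_i + g_j = 0 except for i = j = p, and the sum of all coefficients
    is 0. *)
Lemma legendre_product_coefs (g : {poly rat}) :
  g \is a polyOver Zp -> (size g <= p.*2)%N -> g.[1] = 0 -> g`_0 = 0 ->
  (forall i, i.+1%:R * g`_i.+1 + (i == p.-1)%:R
               - (~~ odd i && (i < p.*2)%N)%:R \in Ip 1) ->
  [/\ g`_p \in Ip 1, 2 * g`_(p + 2) - 1 \in Ip 1 & 2 * g`_(p - 2) + 1 \in Ip 1].
Proof.
move=> gZ sg g1 g0 dg.
have gI i : p%:R * g`_i \in Ip 1.
  by apply/pidealP; exists g`_i; rewrite ?expr1 //; apply: (polyOverP gZ).
have p_odd := prime_odd5.
have g_above : 2 * g`_(p + 2) - 1 \in Ip 1.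
  have := dg p.+1; rewrite (_ : (p.+1 == p.-1) = false); last by lia.
  rewrite (_ : ~~ odd p.+1 && _ = true); last by lia.
  rewrite addr0 -[p.+2]addn2 natrD => h.
  have -> : 2 * g`_(p + 2) - 1 = (p%:R + 2) * g`_(p + 2) - 1 - p%:R * g`_(p + 2).
    by ring.
  by rewrite rpredB.
have g_below : 2 * g`_(p - 2) + 1 \in Ip 1.
  have := dg (p - 3)%N; rewrite (_ : (p - 3 == p.-1)%N = false); last by lia.
  rewrite (_ : ~~ odd (p - 3) && _ = true); last by lia.
  rewrite addr0 (_ : (p - 3).+1 = p - 2)%N; last by lia.
  rewrite natrB; last by lia.
  move=> h.
  have -> : 2 * g`_(p - 2) + 1 = p%:R * g`_(p - 2) - ((p%:R - 2) * g`_(p - 2) - 1).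
    by ring.
  by rewrite rpredB.
have dg_odd j : (0 < j <= p.*2)%N -> j != p -> j%:R * g`_j - (odd j)%:R \in Ip 1.
  case: j => // j /andP[_ j2p] jp; have := dg j.
  by rewrite -(inj_eq succn_inj) prednK ?prime_gt0 // (negPf jp) addr0 j2p andbT.
have gsym i : (i <= p.*2)%N -> i != p -> g`_i + g`_(p.*2 - i) \in Ip 1.
  move=> i2p ip; have [i0|i0] := posnP i.
    by rewrite i0 g0 subn0 nth_default ?addr0 ?rpred0.
  have [->|i2] := eqVneq i p.*2.
    by rewrite subnn g0 nth_default ?addr0 ?rpred0.
  have pi : ~~ (p %| i)%N.
    by apply/negP => /dvdnP[[|[|k]] ik]; move: ik ip i2 i2p i0; nia.
  have h1 : i%:R * g`_i - (odd i)%:R \in Ip 1 by apply: dg_odd; rewrite // i0.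
  have h2 : (p.*2 - i)%:R * g`_(p.*2 - i) - (odd i)%:R \in Ip 1.
    have -> : odd i = odd (p.*2 - i) by rewrite oddB // odd_double.
    by apply: dg_odd; lia.
  apply: (pideal_divn pi); move: h1 h2; set t := (odd i)%:R => h1 h2.
  have -> : i%:R * (g`_i + g`_(p.*2 - i)) = (i%:R * g`_i - t)
     - ((p.*2 - i)%:R * g`_(p.*2 - i) - t) + (p%:R * g`_(p.*2 - i)) *+ 2.
    by rewrite natrB // -muln2 natrM; ring.
  by apply: rpredD; [apply: rpredB | apply: rpredMn].
(* The vanishing sum of the coefficients is added to its reversal. *)
split=> //.
have : \sum_(i < p.*2.+1) (g`_i + g`_(p.*2 - i)) = 0.
  rewrite big_split /=.
  have s1 : \sum_(i < p.*2.+1) g`_i = 0.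
    apply: etrans _ g1; rewrite (horner_coef_wide 1 (leqW sg)).
    by apply: eq_bigr => i _; rewrite expr1n mulr1.
  rewrite s1 add0r; apply: etrans _ s1; rewrite [RHS](reindex_inj rev_ord_inj) /=.
  by apply: eq_bigr => i _; rewrite subSS.
have pp : (p < p.*2.+1)%N by lia.
rewrite (bigD1 (Ordinal pp)) //= (_ : p.*2 - p = p)%N; last by lia.
move/eqP; rewrite addr_eq0 => /eqP gp.
apply: (@pideal_divn _ _ 1 2); first exact: small_ndvd.
rewrite mulr_natl mulr2n gp rpredN; apply: rpred_sum => i ip.
by apply: gsym => //; rewrite -ltnS.
Qed.

(** * The sum modulo p^3 as a polynomial *)

Definition sum_residue : {poly rat} :=
  (- p%:R)%:P + (p%:R + 2 * p%:R ^+ 2) *: 'X^p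
  - (3 / 2 * p%:R ^+ 2) *: 'X^(p.+1) - (2^-1 * p%:R ^+ 2) *: 'X^(p.-1).

(** Expansion of the quartic form with P_p = x^p and P_(p-1) = 1 modulo p.  The
    term with factor p^2 involves only (P_p P_(p-1))^2, which is
    x^(2p) + 2p x^p g modulo p^2; so the expansion is exact modulo p^4. *)
Lemma legendre_form_prime : exists g J : {poly rat},
  [/\ g \is a polyOver Zp, J \is a polyOver Zp,
      [/\ (size g <= p.*2)%N, g`_p \in Ip 1,
          2 * g`_(p + 2) - 1 \in Ip 1 & 2 * g`_(p - 2) + 1 \in Ip 1]
    & 'X^3 * (('X^2 - 1) ^+ 2 * legendre_quartic_sum p)^`() =
      p%:R ^+ 2 * ((1 + 2 * 'X^2 - 3 * 'X^4) * 'X^(p.*2)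
        + 2 * p%:R * ((1 + 2 * 'X^2 - 3 * 'X^4) * 'X^p * g
                  + ('X - 'X^3) * ('X^(3 * p) - 'X^p)) + p%:R ^+ 2 * J)].
Proof.
have [e1 e1Z uE] := legendre_prime_mod.
have [e2 e2Z vE] := legendre_pred_prime_mod.
have [g [gZ gE sg [g1 g0] dg]] := legendre_product.
have [gp ga gb] := legendre_product_coefs gZ sg g1 g0 dg.
rewrite deriv_legendre_quartic_sum.
have uZ := legendre_Zp p; have vZ := legendre_Zp p.-1.
move: (legendre p) (legendre p.-1) uE vE gE uZ vZ => u v uE vE gE uZ vZ.
have wZ : 'X^p \is a polyOver Zp by rewrite rpredX ?polyOverX.
have -> : 'X^(p.*2) = 'X^p ^+ 2 :> {poly rat} by rewrite -exprM muln2.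
have -> : 'X^(3 * p) = 'X^p ^+ 3 :> {poly rat} by rewrite -exprM mulnC.
move: ('X^p : {poly rat}) uE gE wZ => w uE gE wZ.
pose K := g * (u ^+ 2 - v ^+ 2) + w * (2 * w * e1 + p%:R * e1 ^+ 2 - 2 * e2 - p%:R * e2 ^+ 2).
pose J : {poly rat} := 'X^2 * u ^+ 4 - 4 * 'X^3 * u ^+ 3 * v
  + (12 * 'X^4 - 6 * 'X^2) * u ^+ 2 * v ^+ 2 - 4 * 'X^3 * u * v ^+ 3 + 'X^2 * v ^+ 4
  + (1 + 2 * 'X^2 - 3 * 'X^4) * g ^+ 2 + 2 * ('X - 'X^3) * K.
exists g, J; split=> //.
  by rewrite /J /K !(rpred_nat, rpred1, rpredB, rpredD, rpredM, rpredX, polyOverX).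
have KE : u * v * (u ^+ 2 - v ^+ 2) = w ^+ 3 - w + p%:R * K.
  by rewrite gE mulrDl {1}uE {1}vE /K; ring.
transitivity (p%:R ^+ 2 * ((1 + 2 * 'X^2 - 3 * 'X^4) * (u * v) ^+ 2
   + 2 * p%:R * ('X - 'X^3) * (u * v * (u ^+ 2 - v ^+ 2))
   + p%:R ^+ 2 * ('X^2 * u ^+ 4 - 4 * 'X^3 * u ^+ 3 * v
  + (12 * 'X^4 - 6 * 'X^2) * u ^+ 2 * v ^+ 2 - 4 * 'X^3 * u * v ^+ 3 + 'X^2 * v ^+ 4))).
  by rewrite /legendre_form; ring.
by rewrite KE gE /J; ring.
Qed.

(** The previous expansion, read at the coefficient of x^(2m+2). *)
Lemma cleared_sum_coefs : exists g J : {poly rat},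
  [/\ g \is a polyOver Zp, J \is a polyOver Zp,
      [/\ (size g <= p.*2)%N, g`_p \in Ip 1,
          2 * g`_(p + 2) - 1 \in Ip 1 & 2 * g`_(p - 2) + 1 \in Ip 1]
    & forall m, m.*2%:R * (('X - 1) ^+ 2 * square_sum p)`_m
      = p%:R ^+ 2 * ((m.+1 == p)%:R + 2 * (m == p)%:R - 3 * (m == p.+1)%:R
         + 2 * p%:R * (('X^p * g)`_m.*2.+2 + 2 * ('X^p * g)`_m.*2 - 3 * ('X^(p + 4) * g)`_m.*2.+2
              + (m.*2.+1 == 3 * p)%:R - (m.*2.+1 == p)%:R - (m.*2.+2 == 3 * p + 3)%:R + (m.*2.+2 == p + 3)%:R)
         + p%:R ^+ 2 * J`_m.*2.+2)].
Proof.
have [g [J [gZ JZ gP E]]] := legendre_form_prime; exists g, J; split=> // m.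
rewrite -coef_square_sum_deriv E.
have -> : p%:R ^+ 2 * ((1 + 2 * 'X^2 - 3 * 'X^4) * 'X^(p.*2)
        + 2 * p%:R * ((1 + 2 * 'X^2 - 3 * 'X^4) * 'X^p * g
                  + ('X - 'X^3) * ('X^(3 * p) - 'X^p)) + p%:R ^+ 2 * J)
  = p%:R ^+ 2 *: ('X^(p.*2) + 2 *: 'X^(p.*2 + 2) - 3 *: 'X^(p.*2 + 4)
     + (2 * p%:R) *: ('X^p * g + 2 *: ('X^2 * ('X^p * g)) - 3 *: ('X^(p + 4) * g)
       + 'X^(3 * p + 1) - 'X^(p + 1) - 'X^(3 * p + 3) + 'X^(p + 3)) + p%:R ^+ 2 *: J).
  rewrite -!mul_polyC !polyC_exp !polyCM !polyC_natr !exprD; ring.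
rewrite !(coefZ, coefD, coefN) !coefXn [('X^2 * _)`_ _]coefXnM /= subn2 /=.
have -> : (m.*2.+2 == p.*2) = (m.+1 == p) by lia.
have -> : (m.*2.+2 == p.*2 + 2)%N = (m == p) by lia.
have -> : (m.*2.+2 == p.*2 + 4)%N = (m == p.+1) by lia.
have -> : (m.*2.+2 == 3 * p + 1)%N = (m.*2.+1 == 3 * p)%N by lia.
have -> : (m.*2.+2 == p + 1)%N = (m.*2.+1 == p)%N by lia.
by [].
Qed.

Lemma cleared_sum_coef_default m : (p.*2 < m)%N -> (('X - 1) ^+ 2 * square_sum p)`_m = 0.
Proof.
move=> pm; have <- : (('X^2 - 1) ^+ 2 * legendre_quartic_sum p)`_(m * 2)
  = (('X - 1) ^+ 2 * square_sum p)`_m.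
  by rewrite -square_sum_comp coef_comp_poly_Xn // dvdn_mull // mulnK.
rewrite nth_default //; apply: leq_trans (size_polyMleq _ _) _.
have : (size ((('X^2 - 1) : {poly rat}) ^+ 2) <= 5)%N.
  by apply: leq_trans (size_poly_exp_leq _ _) _; rewrite size_XnsubC.
have := size_legendre_quartic_sum p.
move: (size _) (size _) => s t; lia.
Qed.

Lemma coef_sum_residue m : (0 < m)%N -> sum_residue`_m
  = (p%:R + 2 * p%:R ^+ 2) * (m == p)%:R - 3 / 2 * p%:R ^+ 2 * (m == p.+1)%:R
    - 2^-1 * p%:R ^+ 2 * (m.+1 == p)%:R.
Proof.
move=> m0; rewrite /sum_residue !(coefD, coefN, coefZ) !coefXn coefC.
rewrite (_ : (m == 0)%N = false) ?sub0r ?add0r; last by lia.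
by rewrite (_ : (m == p.-1) = (m.+1 == p)) //; lia.
Qed.

Lemma sum_residue_at1 : sum_residue.[1] = 0.
Proof.
rewrite /sum_residue !(hornerD, hornerN, hornerZ, hornerXn, hornerC) !expr1n.
by field.
Qed.

(** Exponents prime to p are obtained by division by 2m, and y^p and y^(2p)
    by division by 2p and 4p in a congruence modulo p^4.  There is nothing
    beyond y^(2p), and the constant coefficient follows from the value 0 of
    both sides at y = 1. *)
Lemma square_sum_congruence :
  ('X - 1) ^+ 2 * square_sum p - sum_residue \is a polyOver (Ip 3).
Proof.
have [g [J [gZ JZ [sg gp ga gb] E]]] := cleared_sum_coefs.
apply: (@polyOver_pideal_but1 _ p_prime _ 0) => [m m0|]; last first.
  rewrite hornerD hornerN hornerM horner_exp hornerD hornerX hornerN hornerC.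
  by rewrite subrr mul0r sum_residue_at1 subrr rpred0.
have {}m0 : (0 < m)%N by rewrite lt0n.
have dbl q : q.*2%:R = 2 * q%:R :> rat by rewrite -mul2n natrM.
have JZp j : J`_j \in Zp by apply: (polyOverP JZ).
have JI j : p%:R ^+ 3 * J`_j \in Ip 3 by apply/pidealP; exists J`_j.
have pJI j : p%:R ^+ 4 * J`_j \in Ip 3.
  by rewrite exprS -mulrA pideal_mulr // rpred_nat.
rewrite coefB coef_sum_residue //; set r := (_ * square_sum p)`_m.
have [pm|pm] := boolP (p %| m)%N.
  have [mp|mp] := ltnP p.*2 m.
    rewrite /r cleared_sum_coef_default //.
    have [-> -> ->] : [/\ (m == p) = false, (m == p.+1) = false & (m.+1 == p) = false].
      by split; lia.
    by rewrite !mulr0 !subr0 rpred0.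
  move/dvdnP: pm => [k km].
  have k12 : k = 1%N \/ k = 2%N by move: m0 mp; rewrite km; case: k {km} => [|[|[|k]]]; nia.
  case: k12 => kE; rewrite {}kE ?mul1n in km.
    (* The exponent p, where g_(p+2) + 2 g_p - 3 g_(p-2) = 2 modulo p. *)
    have := E m; rewrite -/r km !coefXnM eqxx.
    have [-> -> ->] : [/\ (p.*2.+2 < p)%N = false, (p.*2 < p)%N = false
        & (p.*2.+2 < p + 4)%N = false] by split; lia.
    have [-> -> ->] : [/\ (p.*2.+2 - p = p + 2)%N, (p.*2 - p = p)%N
        & (p.*2.+2 - (p + 4) = p - 2)%N] by split; lia.
    have [-> ->] : (p.+1 == p) = false /\ (p == p.+1) = false by split; lia.
    have [-> -> -> ->] : [/\ (p.*2.+1 == 3 * p)%N = false, (p.*2.+1 == p)%N = false,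
        (p.*2.+2 == 3 * p + 3)%N = false & (p.*2.+2 == p + 3)%N = false] by split; lia.
    have /pidealP[a aZ aE] := ga; have /pidealP[b bZ bE] := gp.
    have /pidealP[c cZ cE] := gb.
    rewrite dbl /= => e.
    have r2 : 2 * r = p%:R * (2 + 2 * p%:R * (g`_(p + 2) + 2 * g`_p - 3 * g`_(p - 2))
        + p%:R ^+ 2 * J`_p.*2.+2).
      by apply: (mulfI (natr_prime_neq0 p_prime)); rewrite mulrA [_ * 2]mulrC e; ring.
    apply: (@pideal_divn _ p_prime _ 2); first exact: small_ndvd.
    apply/pidealP; exists (a + 4 * b - 3 * c + J`_p.*2.+2).
      by rewrite !(rpred_nat, rpredB, rpredD, rpredM).
    transitivity (p%:R ^+ 2 * ((2 * g`_(p + 2) - 1) + 4 * g`_p - 3 * (2 * g`_(p - 2) + 1))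
        + p%:R ^+ 3 * J`_p.*2.+2).
      by rewrite mulrBr r2; ring.
    by rewrite aE bE cE; ring.
  (* The exponent 2p, out of reach of x^p g as g has degree less than 2p. *)
  have := E m; rewrite -/r km !coefXnM.
  have [-> -> ->] : [/\ ((2 * p).*2.+2 < p)%N = false, ((2 * p).*2 < p)%N = false
        & ((2 * p).*2.+2 < p + 4)%N = false] by split; lia.
  have [-> -> ->] : [/\ (2 * p == p)%N = false, (2 * p == p.+1)%N = false
        & ((2 * p).+1 == p)%N = false] by split; lia.
  have [-> -> -> ->] : [/\ ((2 * p).*2.+1 == 3 * p)%N = false,
      ((2 * p).*2.+1 == p)%N = false,
      ((2 * p).*2.+2 == 3 * p + 3)%N = false & ((2 * p).*2.+2 == p + 3)%N = false].
    by split; lia.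
  have g_big i : (p.*2 <= i)%N -> g`_i = 0.
    by move=> ip; rewrite nth_default // (leq_trans sg).
  rewrite !g_big; [|lia|lia|lia].
  rewrite dbl natrM /= => e.
  rewrite !mulr0 !subr0.
  apply: (@pideal_divn _ p_prime _ 4); first exact: small_ndvd.
  have -> : 4 * r = p%:R ^+ 3 * J`_(2 * p).*2.+2.
    by apply: (mulfI (natr_prime_neq0 p_prime));
      transitivity (2 * (2 * p%:R) * r); [ring|rewrite e; ring].
  exact: JI.
(* The exponents prime to p; only p-1 and p+1 contribute. *)
have m2 : ~~ (p %| m.*2)%N.
  by rewrite -muln2 Euclid_dvdM // negb_or pm small_ndvd.
apply: (pideal_divn m2); rewrite mulrBr E.
have XgZ q i : ('X^q * g)`_i \in Zp.
  by apply/polyOverP/rpredM => //; rewrite rpredX ?polyOverX.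
set B := (B in 2 * p%:R * B).
have BZ : B \in Zp by rewrite /B !(rpred_nat, rpredB, rpredD, rpredM).
have pBI : p%:R ^+ 3 * (2 * B) \in Ip 3.
  by apply/pidealP; exists (2 * B) => //; rewrite rpredM ?rpred_nat.
have -> : (m == p) = false by apply: contraNF pm => /eqP->.
have e1I : (m.+1 == p)%:R * (m.+1%:R - p%:R) = 0 :> rat.
  by case: eqP => [->|_]; rewrite ?subrr ?mulr0 ?mul0r.
have e2I : (m == p.+1)%:R * (m.+1%:R - p%:R - 2) = 0 :> rat.
  case: eqP => [->|_]; rewrite ?mul0r // mul1r -!natr1; ring.
set e1 := (m.+1 == p)%:R in e1I *; set e2 := (m == p.+1)%:R in e2I *.
have eI : p%:R ^+ 3 * (e1 + 3 * e2) \in Ip 3.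
  by apply/pidealP; exists (e1 + 3 * e2); rewrite // rpredD ?rpredM ?rpred_nat.
rewrite -natr1 in e1I e2I.
have -> : p%:R ^+ 2 * (e1 + 2 * 0 - 3 * e2 + 2 * p%:R * B + p%:R ^+ 2 * J`_m.*2.+2)
   - m.*2%:R * ((p%:R + 2 * p%:R ^+ 2) * 0 - 3 / 2 * p%:R ^+ 2 * e2 - 2^-1 * p%:R ^+ 2 * e1)
  = p%:R ^+ 3 * (e1 + 3 * e2) + p%:R ^+ 3 * (2 * B) + p%:R ^+ 4 * J`_m.*2.+2
     + p%:R ^+ 2 * (e1 * (m%:R + 1 - p%:R)) + 3 * p%:R ^+ 2 * (e2 * (m%:R + 1 - p%:R - 2)).
  by rewrite dbl; field.
rewrite e1I e2I !mulr0 !addr0 rpredD //; exact: rpredD.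
Qed.

(** * Specialization of the polynomial congruence *)

Lemma square_sum_Zp n : square_sum n \is a polyOver Zp.
Proof.
apply: rpred_sum => k _; apply: rpredM; first by rewrite rpredX ?rpred_nat.
by rewrite rpredX // legendre_sq_Zp.
Qed.

(** Modulo p^2 the residue polynomial is - p + p y^p = p (y-1)^p, and the monic
    factor (y-1)^2 can be cancelled. *)
Lemma square_sum_near1 : square_sum p - p%:R * ('X - 1) ^+ (p - 2)
  \is a polyOver (Ip 2).
Proof.
apply: (@polyOver_divXn1 _ _ _ 1) => //; apply: (@polyOver_divXn1 _ _ _ 1) => //.
have XZ : ('X : {poly rat}) \is a polyOver Zp by rewrite polyOverX.
have X1Z : ('X - 1 : {poly rat}) \is a polyOver Zp by rewrite rpredB ?rpred1.
have := polyOver_pideal_le (isT : (2 <= 3)%N) square_sum_congruence.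
have /polyOver_pidealP[e eZ] := binomial_prime X1Z; rewrite subrK => eE.
have halfZ : (2^-1)%:P \is a polyOver Zp.
  by rewrite polyOverC (plocal_inv _ (n := 2)) // small_ndvd.
have -> : 'X^1 - 1 = 'X - 1 :> {poly rat} by [].
have p2 : ('X - 1) * (('X - 1) * ('X - 1) ^+ (p - 2)) = ('X - 1) ^+ p :> {poly rat}.
  by rewrite -!exprS -[in RHS](@subnK 2 p) ?addn2 // (leq_trans _ p_ge5).
rewrite !mulrBr [('X - 1) * (p%:R * _)]mulrCA [('X - 1) * (p%:R * _)]mulrCA p2.
have pXE : ('X - 1) ^+ p = 'X^p - 1 - p%:R ^+ 1 * e :> {poly rat}.
  by rewrite -eE; ring.
set M := (_ - sum_residue) => MI.
have -> : ('X - 1) * (('X - 1) * square_sum p) - p%:R * ('X - 1) ^+ p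
  = M + p%:R ^+ 2 * (e + 2 * 'X^p - (3 * 2^-1)%:P * 'X^(p.+1) - (2^-1)%:P * 'X^(p.-1)).
  rewrite pXE /M /sum_residue -!mul_polyC !polyCN.
  rewrite !(polyC_natr, polyC_exp, polyCM, polyCD).
  ring.
rewrite rpredD // polyOver_mulp //.
by rewrite !(rpred_nat, rpredB, rpredD, rpredM, rpredX, polyCM, polyC_natr).
Qed.

(** Fermat's little theorem is applied to the absolute value; as p-1 is even,
    this does not change the power. *)
Lemma fermat_quotient_Zp (a : int) : ~~ (p %| a)%Z -> fermat_quotient p a \in Zp.
Proof.
move=> pa; rewrite /fermat_quotient.
have : (p %| a ^+ p.-1 - 1)%Z.
  have p_odd := prime_odd5.
  have -> : a ^+ p.-1 = (`|a| ^ p.-1)%N%:Z.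
    have -> : p.-1 = (2 * p./2)%N by rewrite mul2n -[in LHS](odd_double_half p) p_odd.
    rewrite -[(_ ^ _)%N%:Z]natz natrX natz !exprM abszE real_normK //.
    exact: num_real.
  have : (p %| `|a|%N%:Z * ((`|a| ^ p.-1)%N%:Z - 1))%Z.
    rewrite mulrBr mulr1 -PoszM -expnS prednK ?prime_gt0 //.
    by rewrite -eqz_mod_dvd !modz_nat eqz_nat; apply/eqP/fermat_little.
  by rewrite Euclid_dvdz // => /orP[/(negP pa)|].
by case/dvdzP=> q ->; rewrite rmorphM /= mulfK ?natr_prime_neq0 // Zloc_int.
Qed.

Lemma square_sum_congruence_at y : y \in Zp -> exists2 t, t \in Zp &
  (y - 1) ^+ 2 * (square_sum p).[y]
  = - p%:R + (p%:R + 2 * p%:R ^+ 2) * y ^+ p - 3 / 2 * p%:R ^+ 2 * y ^+ p.+1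
    - 2^-1 * p%:R ^+ 2 * y ^+ p.-1 + p%:R ^+ 3 * t.
Proof.
move=> yZ; have /polyOver_pidealP[e eZ eE] := square_sum_congruence.
exists e.[y]; first exact: rpred_horner.
have /(congr1 (horner^~ y)) := eE.
rewrite -polyC_natr -polyC_exp hornerCM hornerD hornerN hornerM horner_exp.
rewrite hornerD hornerX hornerN hornerC => <-.
rewrite /sum_residue !(hornerD, hornerN, hornerZ, hornerXn, hornerC).
by rewrite [RHS]addrC subrK.
Qed.

Lemma square_sum_congr1 y : y - 1 \in Ip 1 ->
  (square_sum p).[y] - - p%:R ^+ 2 \in Ip 3.
Proof.
move=> yI; have /pidealP[t tZ] := yI; rewrite expr1 => tE.
have yZ : y \in Zp by rewrite -(subrK 1 y) tE !(rpred_nat, rpredD, rpredM, rpred1).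
have /polyOver_pidealP[e eZ eE] := square_sum_near1.
have sE x : (square_sum p).[x] = p%:R * (x - 1) ^+ (p - 2) + p%:R ^+ 2 * e.[x].
  have /(congr1 (horner^~ x)) := eE.
  rewrite -polyC_natr -polyC_exp hornerCM hornerD hornerN hornerCM horner_exp.
  by rewrite hornerD hornerX hornerN hornerC => <-; rewrite addrC subrK.
(* The power of y - 1 vanishes at 1, where the sum is explicit. *)
have e1 : p%:R ^+ 2 * e.[1] = p%:R ^+ 2 * (2 * p%:R ^+ 2 - 1).
  have := sE 1; rewrite square_sum_at1 subrr expr0n.
  by rewrite (_ : (p - 2 == 0)%N = false) ?mulr0 ?add0r //; lia.
have /pidealP[q qZ qE] : e.[y] - e.[1] \in Ip 1 by rewrite horner_pideal ?rpred1.
apply/pidealP; exists (p%:R ^+ (p - 4) * t ^+ (p - 2) + q + 2 * p%:R).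
  by rewrite !(rpred_nat, rpredD, rpredM, rpredX).
rewrite sE tE exprMn.
(* Since p - 2 >= 2, the power of y - 1 contributes p^2. *)
have -> : (p - 2 = 2 + (p - 4))%N by lia.
rewrite exprD.
transitivity (p%:R * (p%:R ^+ 2 * p%:R ^+ (p - 4) * t ^+ (2 + (p - 4)))
  + p%:R ^+ 2 * (e.[y] - e.[1]) + (p%:R ^+ 2 * e.[1] + p%:R ^+ 2)); first by ring.
by rewrite e1 qE; ring.
Qed.

Lemma square_sum_congr0 y : y \in Ip 2 ->
  (square_sum p).[y] - - p%:R \in Ip 3.
Proof.
move=> yI; have /pidealP[z zZ zE] := yI.
have yZ : y \in Zp by rewrite zE !(rpred_nat, rpredX, rpredM).
have [t tZ] := square_sum_congruence_at yZ.
have h2 : 2^-1 \in Zp by apply: (plocal_inv _ (n := 2)); apply: small_ndvd.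
have sZ : (square_sum p).[y] \in Zp by rewrite rpred_horner // square_sum_Zp.
move: (square_sum p).[y] sZ => s sZ sE.
have yX n : (0 < n)%N -> exists2 w, w \in Zp & y ^+ n = p%:R ^+ 2 * w.
  case: n => // n _; exists (z * y ^+ n); last by rewrite exprS {1}zE mulrA.
  by rewrite rpredM ?rpredX.
have [y1 y1Z y1E] := yX p (prime_gt0 p_prime).
have [|y2 y2Z y2E] := yX p.+1; first by [].
have [|y0 y0Z y0E] := yX p.-1; first by rewrite -subn1 subn_gt0 prime_gt1.
have {sE} [k kZ sE] : exists2 k, k \in Zp &
    (y - 1) ^+ 2 * s = - p%:R + p%:R ^+ 3 * k.
  exists ((1 + 2 * p%:R) * y1 - 3 / 2 * p%:R * y2 - 2^-1 * p%:R * y0 + t).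
    by rewrite !(rpred_nat, rpred1, rpredB, rpredD, rpredM).
  by rewrite sE y0E y1E y2E; field.
(* The sum s is divisible by p, so that y s is divisible by p^3 and
   (y-1)^2 s = s modulo p^3. *)
have [r rZ sI] : exists2 r, r \in Zp & s = p%:R * r.
  exists (p%:R ^+ 2 * k - 1 + 2 * p%:R * z * s - p%:R * z * y * s).
    by rewrite !(rpred_nat, rpred1, rpredB, rpredD, rpredM, rpredX).
  transitivity ((y - 1) ^+ 2 * s + 2 * y * s - y * y * s); first by ring.
  by rewrite sE {1 2}zE; ring.
apply/pidealP; exists (k + 2 * z * r - z * y * r).
  by rewrite !(rpred_nat, rpredB, rpredD, rpredM).
transitivity ((y - 1) ^+ 2 * s + p%:R + 2 * y * s - y * y * s); first by ring.
by rewrite sE {1}sI [in X in _ - X]sI {1 2}zE; ring.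
Qed.

(** Division by the unit (y-1)^2.  Here y^(p-1) = (b^(p-1))^2 / d^(p-1), so
    that (y^(p-1) - 1) / p is 2 q_p(b) - q_p(d) modulo p. *)
Lemma square_sum_congr_unit b c d y qb qd : d = b ^+ 2 - 4 * c -> y = b ^+ 2 / d ->
  d != 0 -> c != 0 -> y \in Zp -> (y - 1)^-1 \in Zp -> d^-1 \in Zp ->
  qb \in Zp -> qd \in Zp ->
  b ^+ p.-1 = 1 + p%:R * qb -> d ^+ p.-1 = 1 + p%:R * qd ->
  (square_sum p).[y] - (p%:R * (d / (4 * c)) - p%:R ^+ 2 * (d / (4 * c))
     * (b ^+ 2 / (4 * c) * (qd - 2 * qb) + 1 + 12 * c / (2 * d))) \in Ip 3.
Proof.
move=> dE yE d0 c0 yZ y1Z dVZ qbZ qdZ bX dX.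
have [t tZ] := square_sum_congruence_at yZ.
have h2 : 2^-1 \in Zp by apply: (plocal_inv _ (n := 2)); apply: small_ndvd.
pose w := d^-1 ^+ p.-1 * (2 * qb + p%:R * qb ^+ 2 - qd).
have wZ : w \in Zp by rewrite /w !(rpred_nat, rpredB, rpredD, rpredM, rpredX).
have dX0 : 1 + p%:R * qd != 0 by rewrite -dX expf_neq0.
have yX : y ^+ p.-1 = 1 + p%:R * w.
  rewrite yE expr_div_n -exprM mulnC exprM bX dX /w exprVn dX.
  by field.
have qE : qd - 2 * qb = - (w + p%:R * (w * qd - qb ^+ 2)).
  by rewrite /w exprVn dX; field.
have yp : y ^+ p = y * (1 + p%:R * w).
  by rewrite -{1}(prednK (prime_gt0 p_prime)) exprS yX.
rewrite [y ^+ p.+1]exprS yp yX qE.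
(* In terms of d and y alone, the claim is an identity of rational
   functions. *)
have cE : c = d * (y - 1) / 4 by rewrite yE dE; field; rewrite -dE.
have bE : b ^+ 2 = d * y by rewrite yE; field.
have y10 : y - 1 != 0.
  by apply: contraNneq c0; rewrite cE => ->; rewrite mulr0 mul0r.
move: ((square_sum p).[y]) => s sE.
apply/pidealP.
exists ((t + 2 * y * w - 3 / 2 * y ^+ 2 * w - 2^-1 * w - y * (w * qd - qb ^+ 2)) * (y - 1)^-1 ^+ 2).
  by rewrite !(rpred_nat, rpredB, rpredD, rpredM, rpredX).
have -> : s = ((y - 1) ^+ 2 * s) / (y - 1) ^+ 2.
  by rewrite mulrC mulKf // expf_neq0.
rewrite bE cE sE; field.
by rewrite d0 y10.
Qed.

End AtPrime.

Theorem theorem2 (p : nat) (b c d : int)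
    (p_prime : prime p) (p_ge5 : (5 <= p)%N)
    (d_def : d = b ^+ 2 - 4 * c) (p_ndvd_d : ~~ (p %| d)%Z) :
  [/\ (p %| c)%Z ->
        rat_congr p 3 (trinomial_sum p b c d) (- p%:R ^+ 2),
      (p %| b)%Z ->
        rat_congr p 3 (trinomial_sum p b c d) (- p%:R)
    & ~~ (p %| c)%Z -> ~~ (p %| b)%Z ->
        rat_congr p 3 (trinomial_sum p b c d)
          (p%:R * (d%:~R / (4 * c%:~R))
           - p%:R ^+ 2 * (d%:~R / (4 * c%:~R))
             * (b%:~R ^+ 2 / (4 * c%:~R)
                  * (fermat_quotient p d - 2 * fermat_quotient p b)
                + 1 + 12 * c%:~R / (2 * d%:~R)))].
Proof.
have nz (a : int) : ~~ (p %| a)%Z -> a%:~R != 0 :> rat.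
  by rewrite intr_eq0; apply: contraNneq => ->; apply: dvdz0.
have dR : d%:~R = b%:~R ^+ 2 - 4 * c%:~R :> rat.
  by rewrite d_def rmorphB rmorphXn rmorphM.
have d0 := nz _ p_ndvd_d.
have dVZ := plocal_invz p_prime p_ndvd_d.
have intZ (a : int) : a%:~R \in plocal p_prime by apply: Zloc_int.
rewrite (trinomial_sumE p _ d_def); last by rewrite -(intr_eq0 rat).
set y := b%:~R ^+ 2 / d%:~R; have yZ : y \in plocal p_prime by rewrite rpredM ?rpredX.
have y1 : y - 1 = 4 * c%:~R / d%:~R by rewrite /y dR; field; rewrite -dR.
split=> [pc|pb|pc pb]; apply: (@rat_congr_pideal _ p_prime).
- apply: square_sum_congr1 => //; rewrite y1.
  have /dvdzP[q ->] := pc; apply/pidealP; exists (4 * q%:~R / d%:~R).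
    by rewrite !rpredM ?rpred_nat.
  by rewrite rmorphM /=; ring.
- apply: square_sum_congr0 => //; rewrite /y.
  have /dvdzP[q ->] := pb; apply/pidealP; exists (q%:~R ^+ 2 / d%:~R).
    by rewrite !rpredM ?rpredX.
  by rewrite rmorphM /=; ring.
apply: (@square_sum_congr_unit _ _ p_ge5 _ _ _ y) => //.
- exact: nz.
- rewrite y1 invf_div rpredM // invfM rpredM //.
    by apply: (plocal_inv _ (n := 4)); rewrite small_ndvd.
  exact: plocal_invz.
- exact: fermat_quotient_Zp.
- exact: fermat_quotient_Zp.
- by rewrite /fermat_quotient mulrC divfK ?natr_prime_neq0 // rmorphB rmorphXn subrKC.
- by rewrite /fermat_quotient mulrC divfK ?natr_prime_neq0 // rmorphB rmorphXn subrKC.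
Qed.
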